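(* Let $n\ge1$, let $\{\mathbf{s}_1,\dots,\mathbf{s}_M\}\subset\mathbb{R}^n$ be an arbitrary constellation of $M\ge2$ distinct points, and let the noise have an arbitrary log-concave probability density. Then, for each $i$, the probability of correct decision $P_{ci}$ is a log-concave function of the SNR $\gamma\in(0,\infty)$.
   Context: Setting: the received vector is $\mathbf{r}=\mathbf{s}+\boldsymbol\xi$ in $\mathbb{R}^n$, with $\mathbf{s}$ a constellation point and $\boldsymbol\xi$ noise independent of $\mathbf{s}$. The noise at SNR $\gamma>0$ is a scaled copy of a fixed noise: its density is $p_\gamma(\mathbf{x})=\gamma^{n/2}p_1(\sqrt{\gamma}\,\mathbf{x})$, where $p_1:\mathbb{R}^n\to[0,\infty)$ is a fixed log-concave probability density. (In the Gaussian case $\boldsymbol\xi\sim\mathcal N(\mathbf 0,\gamma^{-1}\mathbf I)$.) The detector outputs the constellation point closest to $\mathbf{r}$ in Euclidean norm, so the decision region of $\mathbf{s}_i$, with the origin shifted to $\mathbf{s}_i$, is the convex polyhedron $\Omega_i=\{\mathbf{x}\in\mathbb{R}^n:\ (\mathbf{s}_j-\mathbf{s}_i)^T\mathbf{x}\le \frac12|\mathbf{s}_j-\mathbf{s}_i|^2\ \ \forall j\ne i\}$, and $P_{ci}(\gamma)=\int_{\Omega_i}p_\gamma(\mathbf{x})\,d\mathbf{x}$. A function $g\ge0$ is log-concave if $\log g$ is concave, with $\log 0=-\infty$. *)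

(* Defs.v *)
From HB Require Import structures.
From mathcomp Require Import all_boot all_order all_algebra.
From mathcomp Require Import all_classical all_reals all_analysis.

Set Implicit Arguments.
Unset Strict Implicit.
Unset Printing Implicit Defensive.

Import Order.TTheory GRing.Theory Num.Theory.
Import numFieldNormedType.Exports.

Local Open Scope classical_set_scope.
Local Open Scope ring_scope.

(* Matrices carry the product sigma-algebra, i.e. the one generated by the
   entries; on 'cV[R]_n this is the Borel sigma-algebra of R^n. *)
Definition mx_entry_sets {d} {T : measurableType d} (m n : nat) :
    set (set 'M[T]_(m, n)) :=
  [set A | exists i j (B : set T),
    measurable B /\ A = (fun M : 'M[T]_(m, n) => M i j) @^-1` B].

Definition mx_display : measure_display -> measure_display.
Proof. exact. Qed.

Section measurable_matrix.
Context {d} {T : measurableType d} (m n : nat).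

Let mx_set0 : <<s @mx_entry_sets d T m n >> set0.
Proof. exact: sigma_algebra0. Qed.

Let mx_setC A :
  <<s @mx_entry_sets d T m n >> A -> <<s @mx_entry_sets d T m n >> (~` A).
Proof. exact: sigma_algebraC. Qed.

Let mx_bigcup (F : (set 'M[T]_(m, n))^nat) :
  (forall i, <<s @mx_entry_sets d T m n >> (F i)) ->
  <<s @mx_entry_sets d T m n >> (\bigcup_i (F i)).
Proof. exact: sigma_algebra_bigcup. Qed.

HB.instance Definition _ := @isMeasurable.Build (mx_display d)
  'M[T]_(m, n) <<s @mx_entry_sets d T m n >> mx_set0 mx_setC mx_bigcup.

End measurable_matrix.

Lemma measurable_mx_entry {d} {T : measurableType d} (m n : nat)
    (i : 'I_m) (j : 'I_n) :
  measurable_fun [set: 'M[T]_(m, n)] (fun M : 'M[T]_(m, n) => M i j).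
Proof.
move=> _ B mB; rewrite setTI; apply: sub_sigma_algebra.
by exists i, j, B.
Qed.

Lemma measurable_fun_mx {d d'} {S : measurableType d} {T : measurableType d'}
    (m n : nat) (f : S -> 'M[T]_(m, n)) :
  (forall i j, measurable_fun setT (fun s => f s i j)) -> measurable_fun setT f.
Proof.
move=> mf; apply: (@measurability _ _ _ _ _ _ (@mx_entry_sets d' T m n)) => //.
move=> _ [_ [i [j [B [mB ->]]]] <-].
exact: mf.
Qed.

Section lebesgue_measure_vector.
Context {R : realType}.
Local Open Scope ereal_scope.

Definition cv_cons (n : nat) (x : measurableTypeR R * 'cV[R]_n) : 'cV[R]_n.+1 :=
  \col_i (if unlift ord0 i is Some j then x.2 j ord0 else x.1).

Definition cv_uncons (n : nat) (v : 'cV[R]_n.+1) : measurableTypeR R * 'cV[R]_n :=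
  (v ord0 ord0, \col_j v (lift ord0 j) ord0).

Lemma cv_consK (n : nat) : cancel (@cv_cons n) (@cv_uncons n).
Proof.
move=> [a v]; rewrite /cv_uncons /cv_cons mxE unlift_none/=; congr pair.
by apply/matrixP => i j; rewrite !mxE liftK [j]ord1.
Qed.

Lemma cv_unconsK (n : nat) : cancel (@cv_uncons n) (@cv_cons n).
Proof.
move=> v; apply/matrixP => i j; rewrite !mxE [j]ord1.
by case: unliftP => [k ->|->] //=; rewrite mxE.
Qed.

Lemma measurable_cv_cons (n : nat) : measurable_fun setT (@cv_cons n).
Proof.
apply: measurable_fun_mx => i j; rewrite /cv_cons.
case: (unliftP ord0 i) => [k ->|->].
- rewrite [X in measurable_fun _ X](_ : _ =
      (fun M : 'cV[R]_n => M k ord0) \o snd); last first.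
    by apply/funext => x; rewrite mxE liftK.
  exact: measurableT_comp (measurable_mx_entry k ord0) measurable_snd.
- rewrite [X in measurable_fun _ X](_ : _ = fst); last first.
    by apply/funext => x; rewrite mxE unlift_none.
  exact: (@measurable_fst _ _ (measurableTypeR R) 'cV[R]_n).
Qed.

Lemma measurable_cv_uncons (n : nat) : measurable_fun setT (@cv_uncons n).
Proof.
apply/measurable_fun_pair => /=; first exact: measurable_mx_entry.
apply: measurable_fun_mx => i j.
rewrite [X in measurable_fun _ X](_ : _ =
    (fun v : 'cV[R]_n.+1 => v (lift ord0 i) ord0)); last first.
  by apply/funext => v; rewrite mxE.
exact: measurable_mx_entry.
Qed.

HB.instance Definition _ (n : nat) :=
  isMeasurableFun.Build _ _ _ _ (@cv_cons n) (@measurable_cv_cons n).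

Section step.
Variables (n : nat) (mu : {sigma_finite_measure set 'cV[R]_n -> \bar R}).

Definition lebesgue_cv_step : set 'cV[R]_n.+1 -> \bar R :=
  pushforward ((@lebesgue_measure R) \x mu) (@cv_cons n).

Let lebesgue_cv_step0 : lebesgue_cv_step set0 = 0.
Proof. by rewrite /lebesgue_cv_step /pushforward preimage_set0 measure0. Qed.

Let lebesgue_cv_step_ge0 A : 0 <= lebesgue_cv_step A.
Proof. exact: measure_ge0. Qed.

Let lebesgue_cv_step_sigma_additive : semi_sigma_additive lebesgue_cv_step.
Proof.
have mcons := @measurable_cv_cons n.
have mpre A : measurable A -> measurable (@cv_cons n @^-1` A).
  by move=> mA; rewrite -[X in measurable X]setTI; exact: mcons.
move=> F mF tF mUF; rewrite /lebesgue_cv_step /pushforward preimage_bigcup.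
apply: measure_semi_sigma_additive.
- by move=> k; exact: mpre.
- apply/trivIsetP => /= i j _ _ ij; rewrite -preimage_setI.
  by move/trivIsetP : tF => /(_ _ _ _ _ ij) ->//; rewrite preimage_set0.
- by rewrite -preimage_bigcup; exact: mpre.
Qed.

HB.instance Definition _ := isMeasure.Build _ _ _ lebesgue_cv_step
  lebesgue_cv_step0 lebesgue_cv_step_ge0 lebesgue_cv_step_sigma_additive.

Let lebesgue_cv_step_sigma_finite : sigma_finite setT lebesgue_cv_step.
Proof.
have /sigma_finiteP[F [TF ndF Foo]] := sigma_finiteT (@lebesgue_measure R).
have /sigma_finiteP[G [TG ndG Goo]] := sigma_finiteT mu.
exists (fun k => @cv_uncons n @^-1` (F k `*` G k)).
  rewrite -preimage_bigcup -(preimage_setT (@cv_uncons n)); congr (_ @^-1` _).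
  apply/seteqP; split => // -[x v] _.
  have [k _ Fkx] : (\bigcup_k F k) x by rewrite -TF.
  have [l _ Glv] : (\bigcup_k G k) v by rewrite -TG.
  exists (maxn k l) => //; split.
  - by move: x Fkx; exact/subsetPset/ndF/leq_maxl.
  - by move: v Glv; exact/subsetPset/ndG/leq_maxr.
move=> k; have [mF Fk] := Foo k; have [mG Gk] := Goo k; split.
  rewrite -[X in measurable X]setTI.
  by apply: measurable_cv_uncons => //; exact: measurableX.
rewrite /lebesgue_cv_step /pushforward -comp_preimage.
rewrite (_ : _ \o _ = id) ?preimage_id; last exact/funext/cv_consK.
by rewrite product_measure1E// lte_mul_pinfty// ge0_fin_numE.
Qed.

HB.instance Definition _ := Measure_isSigmaFinite.Build _ _ _
  lebesgue_cv_step lebesgue_cv_step_sigma_finite.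

End step.

(* Lebesgue measure on R^n: the n-fold product of the one-dimensional one, R^0
   being a single point of mass 1. *)
Fixpoint lebesgue_cv (n : nat) : {sigma_finite_measure set 'cV[R]_n -> \bar R} :=
  match n with
  | 0%N => dirac (0%R : 'cV[R]_0)
  | k.+1 => lebesgue_cv_step (lebesgue_cv k)
  end.

Lemma lebesgue_cv_box (n : nat) (B : 'I_n -> set R) :
  (forall i, measurable (B i)) ->
  lebesgue_cv n [set v | forall i, B i (v i ord0)] =
    \prod_(i < n) lebesgue_measure (B i).
Proof.
elim: n => [|n IHn] in B * => mB.
  rewrite big_ord0 /= diracE mem_set// => -[].
  by move=> [].
rewrite big_ord_recl -IHn; last by move=> i; exact: mB.
rewrite /= /lebesgue_cv_step /pushforward -product_measure1E //; last 2 first.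
- exact: mB.
- rewrite [X in measurable X](_ : _ = \bigcap_(i in [set: 'I_n])
    ((fun v : 'cV[R]_n => v i ord0) @^-1` B (lift ord0 i))); last first.
    by apply/seteqP; split => [v Bv i _|v Bv i]; [exact: Bv|exact: (Bv i I)].
  apply: fin_bigcap_measurable => // i _.
  rewrite -[X in measurable X]setTI.
  by apply: measurable_mx_entry => //; exact: mB.
congr (product_measure1 _ _ _); apply/seteqP; split => [[x v] /= Bxv|[x v] /=].
- split=> [|i]; first by have := Bxv ord0; rewrite mxE unlift_none.
  by have := Bxv (lift ord0 i); rewrite mxE liftK.
- move=> [Bx Bv] i; rewrite mxE.
  by case: unliftP => [j ->|->]; [exact: Bv|exact: Bx].
Qed.

End lebesgue_measure_vector.

Section detection.
Context {R : realType}.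

Definition dotcv (n : nat) (u v : 'cV[R]_n) : R := (u^T *m v) ord0 ord0.

(* Euclidean norm; the library's `|v| on matrices is the sup norm. *)
Definition enorm (n : nat) (v : 'cV[R]_n) : R := Num.sqrt (dotcv v v).

(* [lne] is the logarithm on the extended reals, with [lne 0 = -oo], and
   [0 * -oo = 0] there, so the end points t = 0 and t = 1 are harmless. *)
Definition log_concave_on (V : lmodType R) (D : set V) (g : V -> R) : Prop :=
  (forall x, D x -> 0 <= g x) /\
  (forall x y (t : R), D x -> D y -> 0 <= t <= 1 ->
    (t%:E * lne (g x)%:E + (1 - t)%:E * lne (g y)%:E
      <= lne (g (t *: x + (1 - t) *: y))%:E)%E).

Definition probability_density (n : nat) (p : 'cV[R]_n -> R) : Prop :=
  [/\ measurable_fun setT p, (forall x, 0 <= p x) &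
      (\int[lebesgue_cv n]_x (p x)%:E = 1)%E].

Definition noise_density (n : nat) (p1 : 'cV[R]_n -> R) (gamma : R)
    (x : 'cV[R]_n) : R :=
  gamma `^ (n%:R / 2) * p1 (Num.sqrt gamma *: x).

Definition decision_region (n M : nat) (s : 'I_M -> 'cV[R]_n) (i : 'I_M) :
    set 'cV[R]_n :=
  [set x | forall j, j != i ->
    dotcv (s j - s i) x <= 2^-1 * enorm (s j - s i) ^+ 2].

Definition prob_correct (n M : nat) (s : 'I_M -> 'cV[R]_n)
    (p1 : 'cV[R]_n -> R) (i : 'I_M) (gamma : R) : R :=
  \int[lebesgue_cv n]_(x in decision_region s i) noise_density p1 gamma x.

End detection.

(* Main.v *)
Require Import Defs.
From mathcomp Require Import all_boot all_order all_algebra.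
From mathcomp Require Import all_classical all_reals all_analysis.
From mathcomp Require Import measurable_realfun ring lra.

(** In dimension one, the Brunn-Minkowski inequality, applied to the superlevel
    sets of functions rescaled to have supremum 1 and integrated over the levels,
    gives the Prekopa-Leindler inequality; Fubini's theorem carries it to R^n by
    induction.  It is proved here with dilation factors p and q that need not sum
    to 1: if h (p x + q y) >= f x ^ t * g y ^ (1 - t) for all x, y, then
    \int h >= K ^ n (\int f) ^ t (\int g) ^ (1 - t) with
    K = (p / t) ^ t (q / (1 - t)) ^ (1 - t).
    For c = t a + (1 - t) b, let f, g, h be the noise densities at SNR a, b, c
    restricted to the decision region, with p = t sqrt (a / c) and
    q = (1 - t) sqrt (b / c).  Then p + q <= 1 by concavity of the square root,
    so p x + q y stays in the decision region, which is convex and contains 0,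
    and K ^ n compensates exactly the factors gamma ^ (n / 2) of the densities;
    no change of variables is needed. *)

Set Implicit Arguments.
Unset Strict Implicit.
Unset Printing Implicit Defensive.

Import Order.TTheory GRing.Theory Num.Theory.
Import numFieldNormedType.Exports.
Local Open Scope classical_set_scope.
Local Open Scope ring_scope.

(** * The Brunn-Minkowski inequality on the line *)

(** Dividing the measure of the preimage by [p] gives a measure that agrees with Lebesgue measure on
    half-open intervals, hence on all measurable sets. *)
Lemma lebesgue_measure_affine {R : realType} (p b : R)
    (A : set (measurableTypeR R)) : 0 < p -> measurable A ->
  (lebesgue_measure
      ((fun z : measurableTypeR R => ((z : R) - b) / p)%R @^-1` A) =
    p%:E * lebesgue_measure A)%E.
Proof.
move=> p0 mA.
pose phi (z : measurableTypeR R) : measurableTypeR R := ((z : R) - b) / p.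
have mphi : measurable_fun setT phi.
  by apply: measurable_funM => //; exact: measurable_funB.
have pV0 : 0 <= p^-1 by rewrite invr_ge0 ltW.
pose M : {measure set (measurableTypeR R) -> \bar R} :=
  pushforward lebesgue_measure phi.
pose mu' := mscale (NngNum pV0) (M mphi).
have muE : forall X, ocitv X -> lebesgue_measure X = mu' X.
  move=> _ [[x y] _ <-] /=.
  rewrite /mu' /mscale /= /M /= /pushforward.
  have -> : phi @^-1` `]x, y] = `]p * x + b, p * y + b]%classic.
    apply/seteqP; split => z /=; rewrite !in_itv/= /phi;
      by rewrite ltr_pdivlMr// ler_pdivrMr// ltrBrDr lerBlDr ![_ * p]mulrC.
  rewrite !lebesgue_measure_itv/= !lte_fin ltrD2r ltr_pM2l//.
  case: ifPn => _; last by rewrite mule0.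
  rewrite -!EFinB -EFinM; congr EFin; field; exact: lt0r_neq0.
rewrite [in RHS](lebesgue_measure_unique (mu := mu') muE)// /mu' /mscale/=.
by rewrite muleA -EFinM mulfV ?gt_eqF// mul1e.
Qed.

Lemma brunn_minkowski_half_bounded {R : realType} (p q : R)
    (A B C : set (measurableTypeR R)) : 0 < p -> 0 < q ->
  measurable A -> measurable B -> measurable C ->
  A !=set0 -> has_ubound A -> B !=set0 -> has_lbound B ->
  (forall a b, A a -> B b -> C (p * a + q * b)) ->
  (p%:E * lebesgue_measure A + q%:E * lebesgue_measure B
    <= lebesgue_measure C)%E.
Proof.
move=> p0 q0 mA mB mC A0 Aub B0 Blb ABC.
apply/lee_addgt0Pr => e e0.
have e2p : 0 < e / (2 * p) by rewrite divr_gt0// mulr_gt0.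
have e2q : 0 < e / (2 * q) by rewrite divr_gt0// mulr_gt0.
(* C contains a copy of p A and a copy of q B that overlap in an interval of
   length at most e. *)
have [a Aa ha] := sup_adherent e2p (conj A0 Aub).
have [b Bb hb] := inf_adherent e2q (conj B0 Blb).
set P := (fun z : measurableTypeR R => ((z : R) - q * b) / p) @^-1` A.
set Q := (fun z : measurableTypeR R => ((z : R) - p * a) / q) @^-1` B.
have mpre c r (X : set (measurableTypeR R)) : measurable X ->
    measurable ((fun z : measurableTypeR R => ((z : R) - c) / r) @^-1` X).
  move=> mX; rewrite -[_ @^-1` _]setTI.
  have /(_ measurableT X mX) // :
      measurable_fun setT (fun z : measurableTypeR R => ((z : R) - c) / r).
  by apply: measurable_funM => //; exact: measurable_funB.
have mP : measurable P by exact: mpre.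
have mQ : measurable Q by exact: mpre.
rewrite -(@lebesgue_measure_affine _ p (q * b))// -/P.
rewrite -(@lebesgue_measure_affine _ q (p * a))// -/Q.
(* Split [P] into [P] minus [Q], which is disjoint from [Q] and lies with it in [C], and the overlap
   of [P] and [Q], which costs at most [e]. *)
rewrite (measureDI _ mP mQ) addeAC; apply: leeD.
- rewrite -measureU//; last 2 first.
  + exact: measurableD.
  + by rewrite setDE -setIA setICl setI0.
  apply: le_measure; rewrite ?inE//.
    by apply: measurableU => //; exact: measurableD.
  move=> z [[Pz _]|Qz].
  + have -> : z = p * ((z - q * b) / p) + q * b by field; exact: lt0r_neq0.
    exact: ABC.
  + have -> : z = p * a + q * ((z - p * a) / q) by field; exact: lt0r_neq0.
    exact: ABC.
- pose J : set (measurableTypeR R) :=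
    `[p * a + q * inf B, p * sup A + q * b]%classic.
  apply: (@le_trans _ _ (lebesgue_measure J)).
    have mJ : measurable J by exact: measurable_itv.
    apply: le_measure; rewrite ?in_setE//; first exact: measurableI.
    rewrite /J => z [Pz Qz] /=; rewrite in_itv/=; apply/andP; split.
    + have := ge_inf Blb Qz.
      by rewrite ler_pdivlMr// [_ * q]mulrC lerBrDl.
    + have := ub_le_sup Aub Pz.
      by rewrite ler_pdivrMr// [_ * p]mulrC lerBlDr.
  rewrite /J lebesgue_measure_itv/=.
  case: ifPn => _; last by rewrite lee_fin ltW.
  rewrite -EFinB lee_fin.
  have h1 : p * sup A <= p * a + e / 2.
    have -> : p * a + e / 2 = p * (a + e / (2 * p)) by field; exact: lt0r_neq0.
    by rewrite ler_pM2l//; lra.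
  have h2 : q * b <= q * inf B + e / 2.
    have -> : q * inf B + e / 2 = q * (inf B + e / (2 * q)).
      by field; exact: lt0r_neq0.
    by rewrite ler_pM2l// ltW.
  by lra.
Qed.

(** Truncating [A] from above and [B] from below reduces to the half-bounded case, and continuity
    from below gives the limit. The points [a] and [b] keep the truncations nonempty for large
    [k]. *)
Lemma brunn_minkowski_line {R : realType} (p q : R)
    (A B C : set (measurableTypeR R)) : 0 < p -> 0 < q ->
  measurable A -> measurable B -> measurable C -> A !=set0 -> B !=set0 ->
  (forall a b, A a -> B b -> C (p * a + q * b)) ->
  (p%:E * lebesgue_measure A + q%:E * lebesgue_measure B
    <= lebesgue_measure C)%E.
Proof.
move=> p0 q0 mA mB mC [a Aa] [b Bb] ABC.
pose I (k : nat) : set (measurableTypeR R) := `]-oo, k%:R]%classic.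
pose J (k : nat) : set (measurableTypeR R) := `[- k%:R, +oo[%classic.
have mI k : measurable (I k) by exact: measurable_itv.
have mJ k : measurable (J k) by exact: measurable_itv.
have trunc (S : set (measurableTypeR R)) (U : nat -> set (measurableTypeR R)) :
    measurable S -> (forall k, measurable (U k)) ->
    (forall k l, (k <= l)%N -> U k `<=` U l) -> \bigcup_k U k = setT ->
    lebesgue_measure (S `&` U k) @[k --> \oo] --> lebesgue_measure S.
  move=> mS mU ndU UT; rewrite -[S in X in _ --> X]setIT -UT setI_bigcupr.
  apply: nondecreasing_cvg_mu => [k||].
  - exact: measurableI.
  - by rewrite -setI_bigcupr UT setIT.
  - by move=> k l kl; apply/subsetPset; apply: setIS; exact: ndU.
have cA : lebesgue_measure (A `&` I k) @[k --> \oo] --> lebesgue_measure A.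
  apply: trunc => // [k l kl z|].
    by rewrite /I /= !in_itv/= => /le_trans; apply; rewrite ler_nat.
  apply/seteqP; split => // z _; exists (Num.truncn `|z|).+1 => //.
  by rewrite /I /= in_itv/= (le_trans (ler_norm _))// ltW// truncnS_gt.
have cB : lebesgue_measure (B `&` J k) @[k --> \oo] --> lebesgue_measure B.
  apply: trunc => // [k l kl z|].
    by rewrite /J /= !in_itv/= !andbT; apply: le_trans; rewrite lerN2 ler_nat.
  apply/seteqP; split => // z _; exists (Num.truncn `|z|).+1 => //.
  rewrite /J /= in_itv/= andbT lerNl (le_trans (ler_norm _))// normrN ltW//.
  exact: truncnS_gt.
have cAB : (p%:E * lebesgue_measure (A `&` I k) +
    q%:E * lebesgue_measure (B `&` J k))%E @[k --> \oo] -->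
    (p%:E * lebesgue_measure A + q%:E * lebesgue_measure B)%E.
  apply: cvgeD; [|exact: cvgeZl|exact: cvgeZl].
  by apply: ge0_adde_def; rewrite inE mule_ge0// lee_fin ltW.
apply: (cvge_le _ cAB); near=> k.
apply: brunn_minkowski_half_bounded => //.
- exact: measurableI.
- exact: measurableI.
- exists a; split => //; rewrite /I /= in_itv/= (le_trans (ler_norm _))//.
  by near: k; exact: nbhs_infty_ger.
- by exists k%:R => z [_]; rewrite /I /= in_itv.
- exists b; split => //.
  rewrite /J /= in_itv/= andbT lerNl (le_trans (ler_norm _))// normrN.
  by near: k; exact: nbhs_infty_ger.
- by exists (- k%:R) => z [_]; rewrite /J /= in_itv/= andbT.
- by move=> x y [Ax _] [By _]; exact: ABC.
Unshelve. all: by end_near. Qed.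

(** * Integrals through superlevel sets *)

(** Tonelli on the pairs (l, x) with 0 < l < 1 and l c < f x: the section at x is an interval of
    length min (f x, c) / c. Levels are normalised to ]0, 1[ so that functions with different caps
    can be compared at the same [l]. *)
Lemma integral_mine_level_sets d (T : measurableType d) {R : realType}
    (mu : {sigma_finite_measure set T -> \bar R}) (f : T -> \bar R) (c : R) :
  measurable_fun setT f -> (forall x, 0 <= f x)%E -> 0 < c ->
  (\int[mu]_x mine (f x) c%:E =
   c%:E * \int[lebesgue_measure]_(l in
       (`]0%R, 1%R[%classic : set (measurableTypeR R)))
     mu [set x | (l * c)%:E < f x])%E.
Proof.
move=> mf f0 c0.
pose D : set (measurableTypeR R) := `]0, 1[%classic.
pose S : set (measurableTypeR R * T) :=
  [set z | D z.1 /\ ((z.1 * c)%:E < f z.2)%E].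
have mfst :
    measurable_fun setT (fst : measurableTypeR R * T -> measurableTypeR R).
  exact: measurable_fst.
have mS : measurable S.
  have -> : S = (fst @^-1` D) `&` [set z | ((z.1 * c)%:E < f z.2)%E].
    by apply/seteqP; split.
  apply: measurableI.
    by rewrite -[_ @^-1` _]setTI; apply: mfst => //; exact: measurable_itv.
  rewrite -[X in measurable X]setTI; apply: measurable_lte => //.
    apply/measurable_EFinP; apply: (@measurable_funM _ _ R) => //.
  exact: measurableT_comp.
have ysecE x :
    (lebesgue_measure (ysection S x) = (c^-1)%:E * mine (f x) c%:E)%E.
  have -> : ysection S x = [set l | D l /\ ((l * c)%:E < f x)%E].
    by apply/seteqP; split => l; rewrite /ysection/= inE.
  have := f0 x; case: (f x) => [r| |//] r0.
  - have -> : [set l | D l /\ ((l * c)%:E < r%:E)%E] =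
        `]0, Num.min 1 (r / c)[%classic.
      apply/seteqP; split => l /=;
        rewrite /D /= !in_itv/= lte_fin lt_min ltr_pdivlMr//.
        by move=> [/andP[-> ->] ->].
      by move=> /and3P[-> -> ->].
    rewrite lebesgue_measure_itv/= lte_fin.
    rewrite -EFin_min -EFinM.
    case: ifPn => [_|].
      by rewrite sube0 minr_pMr ?invr_ge0 ?ltW// mulVf ?gt_eqF// minC mulrC.
    rewrite -leNgt ge_min leNgt ltr01/= => rc0.
    have /eqP -> : r == 0.
      rewrite eq_le -[0 <= r]lee_fin r0 andbT.
      by rewrite ler_pdivrMr// mul0r in rc0.
    by rewrite /Num.min c0 mulr0.
  - rewrite (_ : [set l | _] = D); last first.
      by apply/seteqP; split => l; [case|move=> Dl; split => //; exact: ltry].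
    rewrite /D lebesgue_measure_itv/= lte_fin ltr01 sube0 /mine ltNge leey/=.
    by rewrite -EFinM mulVf ?gt_eqF.
have xsecE l : D l -> mu (xsection S l) = mu [set x | ((l * c)%:E < f x)%E].
  move=> Dl; congr (mu _); apply/seteqP; split => x; rewrite /xsection/= inE//=.
  by case.
have xsec0 l : ~ D l -> mu (xsection S l) = 0%E.
  move=> Dl; rewrite (_ : xsection S l = set0) ?measure0//.
  by apply/seteqP; split => x //; rewrite /xsection/= inE/= => -[].
have mmin : measurable_fun setT (fun x => mine (f x) c%:E).
  exact: measurable_mine.
have -> : (\int[lebesgue_measure]_(l in D) mu [set x | (l * c)%:E < f x] =
    \int[lebesgue_measure]_l (mu \o xsection S) l)%E.
  rewrite integral_mkcond; apply: eq_integral => l _; rewrite patchE.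
  have [Dl|Dl] := pselect (D l); first by rewrite mem_set//= xsecE.
  by rewrite memNset//= xsec0.
rewrite -indic_fubini_tonelli_FE// indic_fubini_tonelli//.
rewrite indic_fubini_tonelli_GE//.
under [in RHS]eq_integral do rewrite /= ysecE.
rewrite ge0_integralZl_EFin//; last 2 first.
- by move=> x _; rewrite le_min f0 lee_fin ltW.
- by rewrite invr_ge0 ltW.
by rewrite muleA -EFinM mulfV ?gt_eqF// mul1e.
Qed.

Lemma measurable_level_sets d (T : measurableType d) {R : realType}
    (mu : {sigma_finite_measure set T -> \bar R}) (f : T -> \bar R) (c : R) :
  measurable_fun setT f ->
  measurable_fun setT
    (fun l : measurableTypeR R => mu [set x | ((l * c)%R%:E < f x)%E]).
Proof.
move=> mf.
pose S : set (measurableTypeR R * T) := [set z | ((z.1 * c)%:E < f z.2)%E].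
have mfst :
    measurable_fun setT (fst : measurableTypeR R * T -> measurableTypeR R).
  exact: measurable_fst.
have mS : measurable S.
  rewrite -[X in measurable X]setTI; apply: measurable_lte => //.
    by apply/measurable_EFinP; apply: (@measurable_funM _ _ R).
  exact: measurableT_comp.
have := measurable_fun_xsection mu mS; congr measurable_fun.
apply/funext => l /=; congr (mu _); apply/seteqP.
by split => x; rewrite /xsection/= inE.
Qed.

(** * The Prekopa-Leindler inequality on the line *)

(** Young's inequality for the conjugate exponents 1 / t and 1 / (1 - t), applied to u ^ t and v ^
    (1 - t). *)
Lemma powR_amgm {R : realType} (t u v : R) : 0 < t < 1 -> 0 <= u -> 0 <= v ->
  u `^ t * v `^ (1 - t) <= t * u + (1 - t) * v.
Proof.
move=> /andP[t0 t1] u0 v0; have t1' : 0 < 1 - t by rewrite subr_gt0.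
have := @conjugate_powR R _ _ t^-1 (1 - t)^-1
  (powR_ge0 u t) (powR_ge0 v (1 - t)).
rewrite !invr_gt0 !invrK subrKC => /(_ t0 t1' erefl).
rewrite -!powRrM !mulfV ?gt_eqF// !powRr1//.
by rewrite ![_ * t]mulrC ![_ * (1 - t)]mulrC.
Qed.

(* The inequality k * F ^ t * G ^ (1 - t) <= H with the convention
   0 * +oo = 0, phrased through approximations of F and G from below; marginals
   may take the value +oo. *)
Definition wgm_lt {R : realType} (t k : R) (F G H : \bar R) : Prop :=
  forall a b : R, 0 < a -> 0 < b -> (a%:E < F)%E -> (b%:E < G)%E ->
  ((k * (a `^ t * b `^ (1 - t)))%:E < H)%E.

(** The cap [c] replaces the supremum of [f], which may be infinite: it is the minimum of that
    supremum and some [n] large enough, by monotone convergence, for the truncated integral to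
    exceed [a]. The last clause supplies the nonempty superlevel sets that Brunn-Minkowski needs. *)
Lemma integral_truncated_at_sup d (T : measurableType d) {R : realType}
    (mu : {measure set T -> \bar R}) (f : T -> \bar R) (a : R) :
  measurable_fun setT f -> (forall x, 0 <= f x)%E -> 0 <= a ->
  (a%:E < \int[mu]_x f x)%E ->
  exists c : R, [/\ 0 < c, (a%:E < \int[mu]_x mine (f x) c%:E)%E &
    forall l, l < 1 -> exists x, ((l * c)%:E < f x)%E].
Proof.
move=> mf f0 a0 aint.
have [n an] : exists n : nat, (a%:E < \int[mu]_x mine (f x) n%:R%:E)%E.
  apply: contrapT => /forallNP nan; move: aint; apply/negP; rewrite -leNgt.
  pose g n x := mine (f x) n%:R%:E.
  have g_f x : g n x @[n --> \oo] --> f x.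
    case fx : (f x) => [r| |].
    - apply: cvg_near_cst; near=> n; rewrite /g fx min_l// lee_fin.
      by near: n; exact: nbhs_infty_ger.
    - rewrite (_ : g ^~ x = fun n => n%:R%:E).
        by apply/cvgenyP; exact: cvg_id.
      by apply/funext => n; rewrite /g fx min_r// leey.
    - by have := f0 x; rewrite fx.
  have : (\int[mu]_x g n x)%E @[n --> \oo] --> (\int[mu]_x f x)%E.
    rewrite [X in _ --> X](_ : _ = \int[mu]_x (limn (g ^~ x)))%E; last first.
      by apply: eq_integral => x _; apply/esym/cvg_lim => //; exact: g_f.
    apply: cvg_monotone_convergence => //.
    - by move=> m; exact: measurable_mine.
    - by move=> m x _; rewrite /g le_min f0 lee_fin ler0n.
    - move=> x _ m l ml; rewrite /g le_min ge_min lexx/= ge_min lee_fin ler_nat.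
      by rewrite ml orbT.
  move=> gf; apply: (cvge_le _ gf); near=> m.
  by rewrite leNgt; apply/negP; exact: nan.
pose s := mine (ereal_sup (range f)) n%:R%:E.
have fS x : (f x <= ereal_sup (range f))%E by apply: ereal_sup_ubound; exists x.
(* The integral is positive, so the domain is inhabited and the supremum is not -oo. *)
have [x0 _] : exists x0 : T, True.
  apply: contrapT => /forallNP T0; move: aint; apply/negP; rewrite -leNgt.
  rewrite (_ : \int[mu]_x f x = 0)%E ?lee_fin//.
  by apply: integral0_eq => x _; have := T0 x.
have sfin : s \is a fin_num.
  rewrite ge0_fin_numE ?gt_min ?ltry ?orbT//.
  by rewrite le_min lee_fin ler0n andbT (le_trans (f0 x0)).
have sE x : mine (f x) n%:R%:E = mine (f x) (fine s)%:E.
  rewrite fineK// /s minA; by rewrite (min_l (fS x)).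
have s0 : 0 < fine s.
  rewrite ltNge; apply/negP => s0; move: an; apply/negP; rewrite -leNgt.
  rewrite integral0_eq ?lee_fin// => x _; apply/eqP.
  rewrite eq_le {1}sE ge_min lee_fin s0 orbT/=.
  by rewrite le_min f0 lee_fin ler0n.
exists (fine s); split => //.
  by under eq_integral do rewrite -sE.
move=> l l1.
have : ((l * fine s)%:E < ereal_sup (range f))%E.
  rewrite (@lt_le_trans _ _ (fine s)%:E)//; first by rewrite lte_fin gtr_pMl.
  by rewrite fineK// /s ge_min lexx.
by move=> /ereal_sup_gt[_ [x _ <-]] lx; exists x.
Unshelve. all: by end_near. Qed.

(** With [f], [g], [h] capped at [al], [be], [c], Brunn-Minkowski for the superlevel sets,
    integrated over the levels, bounds the integral of [h] by a sum; weighted AM-GM turns the sum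
    into a product. Writing p = t (p / t) and q = (1 - t) (q / (1 - t)) produces the new
    constant. *)
Lemma prekopa_leindler_line {R : realType} (t p q k : R)
    (f g h : measurableTypeR R -> \bar R) :
  0 < t < 1 -> 0 < p -> 0 < q -> 0 < k ->
  measurable_fun setT f -> measurable_fun setT g -> measurable_fun setT h ->
  (forall x, 0 <= f x)%E -> (forall x, 0 <= g x)%E -> (forall x, 0 <= h x)%E ->
  (forall x y, wgm_lt t k (f x) (g y) (h (p * x + q * y))) ->
  wgm_lt t (k * ((p / t) `^ t * (q / (1 - t)) `^ (1 - t)))
    (\int[lebesgue_measure]_x f x)%E (\int[lebesgue_measure]_x g x)%E
    (\int[lebesgue_measure]_x h x)%E.
Proof.
move=> t01 p0 q0 k0 mf mg mh f0 g0 h0 fgh a b a0 b0 af bg.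
have /andP[t0 t1] := t01; have t1' : 0 < 1 - t by rewrite subr_gt0.
have [al [al0 aal fal]] := integral_truncated_at_sup mf f0 (ltW a0) af.
have [be [be0 bbe gbe]] := integral_truncated_at_sup mg g0 (ltW b0) bg.
pose c := k * (al `^ t * be `^ (1 - t)).
have c0 : 0 < c by rewrite !mulr_gt0// powR_gt0.
pose D : set (measurableTypeR R) := `]0, 1[%classic.
have mD : measurable D by exact: measurable_itv.
pose L (u : measurableTypeR R -> \bar R) (r l : R) : \bar R :=
  lebesgue_measure [set x | ((l * r)%:E < u x)%E].
have mset u (r : R) : measurable_fun setT u ->
    measurable [set x : measurableTypeR R | (r%:E < u x)%E].
  by move=> mu; rewrite -[X in measurable X]setTI; apply: measurable_lte.
have mL u r : measurable_fun setT u -> measurable_fun D (L u r).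
  by move=> mu; apply: measurable_funTS; exact: measurable_level_sets.
have L0 u r l : (0 <= L u r l)%E by exact: measure_ge0.
have Lint u r : measurable_fun setT u -> (forall x, 0 <= u x)%E -> 0 < r ->
    (\int[lebesgue_measure]_x mine (u x) r%:E =
    r%:E * \int[lebesgue_measure]_(l in D) L u r l)%E.
  by move=> *; exact: integral_mine_level_sets.
have pqL : (p%:E * \int[lebesgue_measure]_(l in D) L f al l +
    q%:E * \int[lebesgue_measure]_(l in D) L g be l <=
    \int[lebesgue_measure]_(l in D) L h c l)%E.
  rewrite -(ge0_integralZl_EFin _ _ _ _ (ltW p0))//; last exact: mL.
  rewrite -(ge0_integralZl_EFin _ _ _ _ (ltW q0))//; last exact: mL.
  rewrite -ge0_integralD//; last 4 first.
  - by move=> l _; rewrite mule_ge0// lee_fin ltW.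
  - by apply: measurable_funeM; exact: mL.
  - by move=> l _; rewrite mule_ge0// lee_fin ltW.
  - by apply: measurable_funeM; exact: mL.
  apply: ge0_le_integral => //.
  - by move=> l _; rewrite adde_ge0// mule_ge0// lee_fin ltW.
  - by apply: emeasurable_funD; apply: measurable_funeM; exact: mL.
  - exact: mL.
  move=> l; rewrite /D/= in_itv/= => /andP[l0 l1].
  (* The superlevel sets of [f] and [g] are nonempty because l < 1. The levels l al and l be lead to
     l c because l ^ t l ^ (1 - t) = l. *)
  apply: brunn_minkowski_line => //;
    [exact: mset|exact: mset|exact: mset|exact: fal|exact: gbe|].
  move=> x y /= lx ly.
  have := fgh x y (l * al) (l * be) (mulr_gt0 l0 al0) (mulr_gt0 l0 be0) lx ly.
  rewrite !powRM ?ltW// (_ : _ * _ = l * c)// /c.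
  have lE : l `^ t * l `^ (1 - t) = l.
    by rewrite -powRD ?subrKC ?powRr1 ?ltW// gt_eqF// implybT.
  by rewrite -[in RHS]lE; ring.
have {aal} : ((a / al)%:E < \int[lebesgue_measure]_(l in D) L f al l)%E.
  rewrite -(@lte_pmul2l _ al%:E)// -Lint// -EFinM mulrCA.
  by rewrite mulfV ?gt_eqF// mulr1.
have {bbe} : ((b / be)%:E < \int[lebesgue_measure]_(l in D) L g be l)%E.
  rewrite -(@lte_pmul2l _ be%:E)// -Lint// -EFinM mulrCA.
  by rewrite mulfV ?gt_eqF// mulr1.
rewrite -(@lte_pmul2l _ q%:E)// => bL; rewrite -(@lte_pmul2l _ p%:E)// => aL.
have /lt_le_trans/(_ pqL) := lteD aL bL.
rewrite -(@lte_pmul2l _ c%:E)// -Lint// => abh.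
have hc : (\int[lebesgue_measure]_x mine (h x) c%:E <=
    \int[lebesgue_measure]_x h x)%E.
  apply: ge0_le_integral => //.
  - by move=> x _; rewrite le_min h0 lee_fin ltW.
  - exact: measurable_mine.
  - by move=> x _; rewrite ge_min lexx.
apply: le_lt_trans (lt_le_trans abh hc).
rewrite -[leRHS]/((c * (p * (a / al) + q * (b / be)))%:E) lee_fin.
(* These absorb the weights and the caps: the sum becomes t u + (1 - t) v, while [al] and [be]
   cancel in c u ^ t v ^ (1 - t). *)
pose u := p / t * (a / al); pose v := q / (1 - t) * (b / be).
have u0 : 0 < u by rewrite mulr_gt0// divr_gt0.
have v0 : 0 < v by rewrite mulr_gt0// divr_gt0.
have := powR_amgm t01 (ltW u0) (ltW v0).
rewrite -(ler_pM2l c0) => uv.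
have E1 : p * (a / al) + q * (b / be) = t * u + (1 - t) * v.
  by rewrite /u /v; field; rewrite !gt_eqF.
rewrite E1; apply: le_trans uv.
have E2 : al `^ t * u `^ t = (p / t) `^ t * a `^ t.
  rewrite -!powRM ?ltW// ?divr_gt0//; congr (_ `^ t).
  by rewrite /u; field; rewrite !gt_eqF.
have E3 : be `^ (1 - t) * v `^ (1 - t) =
    (q / (1 - t)) `^ (1 - t) * b `^ (1 - t).
  rewrite -!powRM ?ltW// ?divr_gt0//; congr (_ `^ (1 - t)).
  by rewrite /v; field; rewrite !gt_eqF.
have -> : c * (u `^ t * v `^ (1 - t)) =
    k * ((al `^ t * u `^ t) * (be `^ (1 - t) * v `^ (1 - t))).
  by rewrite /c; ring.
by rewrite E2 E3 le_eqVlt; apply/orP; left; apply/eqP; ring.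
Qed.

(** * Induction on the dimension *)

Lemma integral_lebesgue_cvS {R : realType} (n : nat)
    (f : 'cV[R]_n.+1 -> \bar R) :
  measurable_fun setT f -> (forall v, 0 <= f v)%E ->
  (\int[lebesgue_cv n.+1]_v f v =
   \int[lebesgue_measure]_x \int[lebesgue_cv n]_v f (cv_cons (x, v)))%E.
Proof.
move=> mf f0; have mcons := @measurable_cv_cons R n.
have mfc : measurable_fun setT (f \o @cv_cons R n) by exact: measurableT_comp.
rewrite /= /lebesgue_cv_step.
rewrite (@ge0_integral_pushforward _ _ _ _ R _ mcons)//.
by rewrite preimage_setT (fubini_tonelli1 (f \o @cv_cons R n))//=.
Qed.

Lemma cv_consD {R : realType} (n : nat) (p q x y : R) (v w : 'cV[R]_n) :
  cv_cons (p * x + q * y, p *: v + q *: w) =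
  p *: cv_cons (x, v) + q *: cv_cons (y, w).
Proof.
apply/matrixP => i j; rewrite !mxE.
by case: unliftP => [l _|_] /=; rewrite ?mxE.
Qed.

(** For fixed first coordinates the slices satisfy the hypothesis in dimension [n]. The induction
    hypothesis is then the hypothesis of the one-dimensional inequality for the marginals, with k K
    ^ n as its constant, and integrating over the first coordinate adds the last factor K. *)
Lemma prekopa_leindler {R : realType} (t p q : R) (n : nat) (k : R)
    (f g h : 'cV[R]_n -> \bar R) :
  0 < t < 1 -> 0 < p -> 0 < q -> 0 < k ->
  measurable_fun setT f -> measurable_fun setT g -> measurable_fun setT h ->
  (forall x, 0 <= f x)%E -> (forall x, 0 <= g x)%E -> (forall x, 0 <= h x)%E ->
  (forall x y, wgm_lt t k (f x) (g y) (h (p *: x + q *: y))) ->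
  wgm_lt t (k * ((p / t) `^ t * (q / (1 - t)) `^ (1 - t)) ^+ n)
    (\int[lebesgue_cv n]_x f x)%E (\int[lebesgue_cv n]_x g x)%E
    (\int[lebesgue_cv n]_x h x)%E.
Proof.
move=> t01 p0 q0; have /andP[t0 t1] := t01.
have t1' : 0 < 1 - t by rewrite subr_gt0.
set K := _ `^ t * _.
have K0 : 0 < K by rewrite mulr_gt0// powR_gt0// divr_gt0.
elim: n => [|n IHn] in k f g h *; move=> k0 mf mg mh f0 g0 h0 fgh.
  (* In dimension 0 the measure is a unit mass, so the integrals are the values at 0. *)
  rewrite /= !integral_dirac// !diracT !mul1e expr0 mulr1.
  by have := fgh 0 0; rewrite !scaler0 addr0.
have mcons (u : 'cV[R]_n.+1 -> \bar R) : measurable_fun setT u ->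
    measurable_fun setT (u \o @cv_cons R n).
  by move=> mu; apply: measurableT_comp => //; exact: measurable_cv_cons.
have mslice (u : 'cV[R]_n.+1 -> \bar R) x : measurable_fun setT u ->
    measurable_fun setT (fun v => u (cv_cons (x, v))).
  move=> mu; apply: (measurableT_comp (mcons _ mu)).
  exact: measurable_pair1.
have mmarginal (u : 'cV[R]_n.+1 -> \bar R) : measurable_fun setT u ->
    (forall x, 0 <= u x)%E -> measurable_fun setT
      (fun x : measurableTypeR R => \int[lebesgue_cv n]_v u (cv_cons (x, v)))%E.
  move=> mu u0.
  apply: (measurable_fun_fubini_tonelli_F (u \o @cv_cons R n)) => //=.
  exact: mcons.
rewrite !integral_lebesgue_cvS// exprSr mulrA.
apply: prekopa_leindler_line => //.
- by rewrite mulr_gt0// exprn_gt0.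
- exact: mmarginal.
- exact: mmarginal.
- exact: mmarginal.
- by move=> x; exact: integral_ge0.
- by move=> x; exact: integral_ge0.
- by move=> x; exact: integral_ge0.
move=> x y; apply: IHn => //; [exact: mslice..|].
by move=> v w; rewrite cv_consD.
Qed.

(** * Log-concavity and weighted geometric means *)

Lemma powR_div {R : realType} (r s z : R) : 0 < r -> 0 < s ->
  (r / s) `^ z = r `^ z / s `^ z.
Proof.
move=> r0 s0; rewrite powRM ?invr_ge0 ?(ltW r0) ?(ltW s0)//.
by rewrite -(powR_inv1 (ltW s0)) -powRrM mulN1r powRN.
Qed.

(** Exponentiate the inequality between logarithms. Since [g] is positive at [x] and [y], the left
    side is finite, which excludes the value 0 at the intermediate point. *)
Lemma log_concave_on_wgm {R : realType} (V : lmodType R) (D : set V)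
    (g : V -> R) (t : R) (x y : V) :
  log_concave_on D g -> 0 < t < 1 -> D x -> D y ->
  wgm_lt t 1 (g x)%:E (g y)%:E (g (t *: x + (1 - t) *: y))%:E.
Proof.
move=> [_ glc] /andP[t0 t1] Dx Dy a b a0 b0; rewrite !lte_fin mul1r => agx bgy.
have t1' : 0 < 1 - t by rewrite subr_gt0.
have gx0 := lt_trans a0 agx; have gy0 := lt_trans b0 bgy.
have t01 : 0 <= t <= 1 by rewrite !ltW.
have := glc x y t Dx Dy t01.
set z := t *: x + _; rewrite (lne_EFin gx0) (lne_EFin gy0).
have [gz0|gz0] := ltP 0 (g z); last by rewrite le0_lneNy ?lee_fin// leeNy_eq.
rewrite (lne_EFin gz0) -!EFinM -EFinD lee_fin -!ln_powR -lnM ?posrE ?powR_gt0//.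
rewrite ler_ln ?posrE ?mulr_gt0 ?powR_gt0//.
apply: lt_le_trans; apply: ltr_pM; rewrite ?powR_ge0//.
- by apply: gt0_ltr_powR; rewrite // nnegrE ltW.
- by apply: gt0_ltr_powR; rewrite // nnegrE ltW.
Qed.

(** If [a] or [b] is 0, the left side is -oo. Otherwise [wgm_lt] speaks only of numbers strictly
    below [a] and [b], so a failure is carried over to r a and r b, with r < 1 chosen to put their
    mean [d] halfway between [c] and the mean of [a] and [b]. *)
Lemma wgm_lt_lne {R : realType} (t a b c : R) :
  0 < t < 1 -> 0 <= a -> 0 <= b -> 0 <= c -> wgm_lt t 1 a%:E b%:E c%:E ->
  (t%:E * lne a%:E + (1 - t)%:E * lne b%:E <= lne c%:E)%E.
Proof.
move=> /andP[t0 t1] a0 b0 c0 abc; have t1' : 0 < 1 - t by rewrite subr_gt0.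
have [a_gt0|] := ltP 0 a; last first.
  move=> a_le0; rewrite [lne a%:E]le0_lneNy ?lee_fin// gt0_muleNy ?lte_fin//.
  by rewrite addNye leNye.
have [b_gt0|] := ltP 0 b; last first.
  move=> b_le0; rewrite [lne b%:E]le0_lneNy ?lee_fin// gt0_muleNy ?lte_fin//.
  by rewrite addeNy leNye.
have le_c : a `^ t * b `^ (1 - t) <= c.
  rewrite leNgt; apply/negP => cab.
  pose d := (c + a `^ t * b `^ (1 - t)) / 2.
  have [cd dab] : c < d /\ d < a `^ t * b `^ (1 - t) by rewrite /d !midf_lt.
  have d0 : 0 < d by exact: le_lt_trans cd.
  pose r := d / (a `^ t * b `^ (1 - t)).
  have ab0 : 0 < a `^ t * b `^ (1 - t) by rewrite mulr_gt0// powR_gt0.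
  have r0 : 0 < r by rewrite divr_gt0.
  have r1 : r < 1 by rewrite ltr_pdivrMr// mul1r.
  have := abc (r * a) (r * b) (mulr_gt0 r0 a_gt0) (mulr_gt0 r0 b_gt0).
  rewrite !lte_fin !gtr_pMl// => /(_ r1 r1).
  rewrite mul1r !(powRM _ (ltW r0))// mulrACA -powRD; last first.
    by rewrite (gt_eqF r0) implybT.
  rewrite subrKC powRr1 ?(ltW r0)//.
  by rewrite /r divfK ?gt_eqF// ltNge (ltW cd).
have c_gt0 : 0 < c by apply: lt_le_trans le_c; rewrite mulr_gt0// powR_gt0.
rewrite !lne_EFin// -!EFinM -EFinD lee_fin -!ln_powR -lnM ?posrE ?powR_gt0//.
by rewrite ler_ln ?posrE// mulr_gt0// powR_gt0.
Qed.

(** Moves the factors gamma ^ (n / 2) of the three noise densities into the constant of the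
    pointwise inequality. *)
Lemma wgm_lt_scale {R : realType} (t u v w a b c : R) :
  0 < t < 1 -> 0 < u -> 0 < v -> 0 < w -> wgm_lt t 1 a%:E b%:E c%:E ->
  wgm_lt t (w / (u `^ t * v `^ (1 - t))) (u * a)%:E (v * b)%:E (w * c)%:E.
Proof.
move=> t01 u0 v0 w0 abc x y x0 y0; rewrite !lte_fin => xa yb.
have := abc (x / u) (y / v) (divr_gt0 x0 u0) (divr_gt0 y0 v0).
rewrite !lte_fin !ltr_pdivrMr// ![_ * u]mulrC ![_ * v]mulrC => /(_ xa yb).
rewrite mul1r -(ltr_pM2l w0) => /le_lt_trans; apply.
rewrite le_eqVlt; apply/orP; left; apply/eqP.
by rewrite !powR_div//; field; rewrite !gt_eqF ?powR_gt0.
Qed.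

(** * Decision regions and noise densities *)

Lemma measurable_scalecv {R : realType} (n : nat) (c : R) :
  measurable_fun setT (fun x : 'cV[R]_n => c *: x).
Proof.
apply: measurable_fun_mx => i j.
rewrite (_ : (fun _ => _) = (fun x : 'cV[R]_n => c * x i j)); last first.
  by apply/funext => x; rewrite mxE.
by apply: measurable_funM => //; exact: measurable_mx_entry.
Qed.

Lemma dotcvD {R : realType} (n : nat) (u v w : 'cV[R]_n) (a b : R) :
  dotcv u (a *: v + b *: w) = a * dotcv u v + b * dotcv u w.
Proof. by rewrite /dotcv mulmxDr -!scalemxAr !mxE. Qed.

Lemma measurable_decision_region {R : realType} (n M : nat)
    (s : 'I_M -> 'cV[R]_n) (i : 'I_M) : measurable (decision_region s i).
Proof.
rewrite (_ : decision_region s i = \bigcap_(j in [set j | j != i])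
  [set x | dotcv (s j - s i) x <= 2^-1 * enorm (s j - s i) ^+ 2]); last first.
  by apply/seteqP; split => x.
apply: fin_bigcap_measurable => [|j _]; first exact: finite_finset.
rewrite -[X in measurable X]setTI; apply: measurable_fun_le => //.
have -> : dotcv (s j - s i) =
    fun x => \sum_k (s j - s i) k ord0 * x k ord0.
  by apply/funext => x; rewrite /dotcv mxE; apply: eq_bigr => k _; rewrite mxE.
apply: measurable_sum => k; apply: measurable_funM => //.
exact: measurable_mx_entry.
Qed.

(** Each half-space has a nonnegative bound, that is, contains the origin; hence p + q <= 1 suffices
    in place of p + q = 1. *)
Lemma decision_region_comb {R : realType} (n M : nat) (s : 'I_M -> 'cV[R]_n)
    (i : 'I_M) (p q : R) (x y : 'cV[R]_n) :
  0 <= p -> 0 <= q -> p + q <= 1 ->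
  decision_region s i x -> decision_region s i y ->
  decision_region s i (p *: x + q *: y).
Proof.
move=> p0 q0 pq1 sx sy j ji; rewrite dotcvD.
set c := 2^-1 * _; have c0 : 0 <= c by rewrite mulr_ge0 ?invr_ge0 ?sqr_ge0.
have px := ler_wpM2l p0 (sx j ji); have qy := ler_wpM2l q0 (sy j ji).
apply: le_trans (lerD px qy) _.
by rewrite -mulrDl ler_piMl.
Qed.

(* A change of variables would give the value, but finiteness already follows
   from the Prekopa-Leindler inequality between x |-> g (c *: x), twice, and g,
   with dilation factors c / 2. *)
Lemma log_concave_integral_scale_lty {R : realType} (n : nat)
    (g : 'cV[R]_n -> R) (c : R) :
  measurable_fun setT g -> log_concave_on setT g -> 0 < c ->
  (\int[lebesgue_cv n]_x (g x)%:E < +oo)%E ->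
  (\int[lebesgue_cv n]_x (g (c *: x))%:E < +oo)%E.
Proof.
move=> mg glc c0 gfin; have g0 x : 0 <= g x by have [+ _] := glc; apply.
rewrite ltey; apply/eqP => gcoo.
have half : 0 < (2^-1 : R) < 1 by rewrite invr_gt0 ltr0n invf_lt1 ?ltr1n.
have c20 : 0 < c / 2 by rewrite divr_gt0.
have mgE : measurable_fun setT (fun x => (g x)%:E) by apply/measurable_EFinP.
have mgc : measurable_fun setT (fun x : 'cV[R]_n => (g (c *: x))%:E).
  apply/measurable_EFinP; apply: measurableT_comp => //.
  exact: measurable_scalecv.
have ggg (x y : 'cV[R]_n) : wgm_lt 2^-1 1 (g (c *: x))%:E (g (c *: y))%:E
    (g ((c / 2) *: x + (c / 2) *: y))%:E.
  have := log_concave_on_wgm (x := c *: x) (y := c *: y) glc half I I.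
  by rewrite !scalerA (_ : 1 - 2^-1 = 2^-1) 1?[2^-1 * c]mulrC//; field.
have gE0 x : (0 <= (g x)%:E)%E by rewrite lee_fin.
have := prekopa_leindler half c20 c20 ltr01 mgc mgc mgE
  (fun x => gE0 _) (fun x => gE0 _) gE0 ggg.
rewrite gcoo; set K := _ * _ ^+ n.
have K0 : 0 < K.
  rewrite /K mul1r exprn_gt0// mulr_gt0// powR_gt0// divr_gt0// subr_gt0.
  by case/andP: half.
have gint0 : (0 <= \int[lebesgue_cv n]_x (g x)%:E)%E by exact: integral_ge0.
have gfin' : (\int[lebesgue_cv n]_x (g x)%:E)%E \is a fin_num.
  by rewrite ge0_fin_numE.
pose r := fine (\int[lebesgue_cv n]_x (g x)%:E).
have r0 : 0 <= r by rewrite fine_ge0.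
(* Below an infinite integral every real is admissible; this one, multiplied by [K], gives r + 1,
   more than the integral [r] of [g]. *)
have a0 : 0 < (r + 1) / K by rewrite divr_gt0// ltr_wpDl.
move=> /(_ _ _ a0 a0 (ltry _) (ltry _)).
rewrite -powRD ?subrKC ?powRr1 ?(ltW a0)//; last by rewrite (gt_eqF a0) implybT.
by rewrite mulrC divfK ?gt_eqF// -(fineK gfin') lte_fin -/r ltNge lerDl ler01.
Qed.

Lemma measurable_noise_density {R : realType} (n : nat)
    (p1 : 'cV[R]_n -> R) (gamma : R) :
  measurable_fun setT p1 -> measurable_fun setT (noise_density p1 gamma).
Proof.
move=> mp; apply: measurable_funM => //; apply: measurableT_comp => //.
exact: measurable_scalecv.
Qed.

(** The real-valued integral in [prob_correct] applies [fine], which sends +oo to 0; finiteness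
    makes it the genuine value. *)
Lemma noise_density_integral_fin_num {R : realType} (n : nat)
    (p1 : 'cV[R]_n -> R) (D : set 'cV[R]_n) (gamma : R) :
  probability_density p1 -> log_concave_on setT p1 -> measurable D ->
  0 < gamma ->
  (\int[lebesgue_cv n]_(x in D) (noise_density p1 gamma x)%:E)%E \is a fin_num.
Proof.
move=> [mp p0 p1int] plc mD g0.
have nd0 x : (0 <= (noise_density p1 gamma x)%:E)%E.
  by rewrite lee_fin mulr_ge0 ?powR_ge0.
have mnd : measurable_fun setT (fun x => (noise_density p1 gamma x)%:E).
  by apply/measurable_EFinP; exact: measurable_noise_density.
rewrite ge0_fin_numE; last exact: integral_ge0.
apply: (@le_lt_trans _ _
  (\int[lebesgue_cv n]_x (noise_density p1 gamma x)%:E)%E).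
  exact: ge0_subset_integral.
under eq_integral do rewrite /noise_density EFinM.
rewrite ge0_integralZl_EFin ?powR_ge0//.
- rewrite lte_mul_pinfty ?lee_fin ?powR_ge0//.
  by apply: log_concave_integral_scale_lty; rewrite ?sqrtr_gt0 ?p1int ?ltry.
- by move=> x _; rewrite lee_fin.
- apply/measurable_EFinP; apply: measurableT_comp => //.
  exact: measurable_scalecv.
Qed.

(** After squaring, the two sides differ by t (1 - t) (sqrt a - sqrt b) ^ 2. *)
Lemma sqrt_concave {R : realType} (t a b : R) :
  0 <= t <= 1 -> 0 <= a -> 0 <= b ->
  t * Num.sqrt a + (1 - t) * Num.sqrt b <= Num.sqrt (t * a + (1 - t) * b).
Proof.
move=> /andP[t0 t1] a0 b0.
have t1' : 0 <= 1 - t by rewrite subr_ge0.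
rewrite -{2}(sqr_sqrtr a0) -{2}(sqr_sqrtr b0).
set u := Num.sqrt a; set v := Num.sqrt b.
have u0 : 0 <= u by exact: sqrtr_ge0.
have v0 : 0 <= v by exact: sqrtr_ge0.
rewrite -(@ler_pXn2r _ 2) ?nnegrE ?sqrtr_ge0 ?addr_ge0 ?mulr_ge0//.
rewrite sqr_sqrtr ?addr_ge0 ?mulr_ge0 ?sqr_ge0// -subr_ge0.
rewrite (_ : _ - _ = t * (1 - t) * (u - v) ^+ 2); last by ring.
by rewrite mulr_ge0 ?sqr_ge0// mulr_ge0.
Qed.

(** * Log-concavity in the SNR *)

Theorem theorem3 (R : realType) (n M : nat) (hn : (1 <= n)%N) (hM : (2 <= M)%N)
    (s : 'I_M -> 'cV[R]_n) (hs : injective s)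
    (p1 : 'cV[R]_n -> R) (hp1 : probability_density p1)
    (hp1_lc : log_concave_on [set: 'cV[R]_n] p1) (i : 'I_M) :
  log_concave_on [set gamma : R^o | 0 < gamma] (prob_correct s p1 i).
Proof.
have [mp p0 p1int] := hp1.
have nd0 gamma x : 0 <= noise_density p1 gamma x by rewrite mulr_ge0 ?powR_ge0.
have P0 gamma : 0 <= prob_correct s p1 i gamma.
  by apply: Rintegral_ge0 => x _.
split=> // x y t /= x0 y0 /andP[].
(* The endpoints are treated apart because the constants divide by t and 1 - t; here 0 times -oo is
   0. *)
rewrite le_eqVlt => /predU1P[<- _|t0].
  by rewrite mul0e add0e subr0 mul1e scale0r add0r scale1r.
rewrite le_eqVlt => /predU1P[->|t1].
  by rewrite subrr mul0e adde0 mul1e scale0r addr0 scale1r.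
have t01 : 0 < t < 1 by rewrite t0.
have t1' : 0 < 1 - t by rewrite subr_gt0.
apply: wgm_lt_lne => //.
set z : R := t *: x + (1 - t) *: y.
have z0 : 0 < z by rewrite addr_gt0// mulr_gt0.
(* Extension by zero makes the integrals run over the whole space. *)
pose F gamma :=
  (fun w => (noise_density p1 gamma w)%:E) \_ (decision_region s i).
have mD := measurable_decision_region s i.
have PE gamma : 0 < gamma -> (prob_correct s p1 i gamma)%:E =
    (\int[lebesgue_cv n]_v F gamma v)%E.
  move=> g0; rewrite /prob_correct /Rintegral fineK.
    by rewrite integral_mkcond.
  exact: noise_density_integral_fin_num.
rewrite !PE//.
have mF gamma : measurable_fun setT (F gamma).
  apply/(measurable_restrictT _ mD); apply: measurable_funTS.
  by apply/measurable_EFinP; exact: measurable_noise_density.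
have F0 gamma v : (0 <= F gamma v)%E.
  by apply: erestrict_ge0 => w _; rewrite lee_fin.
have S0 gamma : 0 < gamma -> 0 < Num.sqrt gamma by rewrite sqrtr_gt0.
(* Chosen so that sqrt z (p v + q w) = t (sqrt x v) + (1 - t) (sqrt y w), the convex combination of
   the arguments of [p1]. *)
pose p := t * Num.sqrt x / Num.sqrt z.
pose q := (1 - t) * Num.sqrt y / Num.sqrt z.
have pp : 0 < p by rewrite divr_gt0 ?S0// mulr_gt0 ?S0.
have qp : 0 < q by rewrite divr_gt0 ?S0// mulr_gt0 ?S0.
have pq1 : p + q <= 1.
  rewrite -mulrDl ler_pdivrMr ?S0// mul1r.
  by apply: sqrt_concave; rewrite ?ltW// t0 ltW.
pose m (gamma : R) := gamma `^ (n%:R / 2).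
have m0 gamma : 0 < gamma -> 0 < m gamma by move=> ?; rewrite powR_gt0.
have mE (gamma : R) : 0 < gamma -> m gamma = Num.sqrt gamma ^+ n.
  move=> g0; rewrite /m mulrC powRrM powR12_sqrt ?ltW// powR_mulrn ?ltW ?S0//.
pose k := m z / (m x `^ t * m y `^ (1 - t)).
have k0 : 0 < k by rewrite divr_gt0 ?mulr_gt0 ?powR_gt0 ?m0.
have FK v w : wgm_lt t k (F x v) (F y w) (F z (p *: v + q *: w)).
  rewrite /F !patchE => a b a0 b0.
  (* Outside the region [F] is 0, and no positive number lies below it. *)
  have [Dv|Dv] := pselect (decision_region s i v); last first.
    by rewrite (memNset Dv) lte_fin ltNge (ltW a0).
  have [Dw|Dw] := pselect (decision_region s i w); last first.
    by rewrite [w \in _]memNset// => _; rewrite lte_fin ltNge (ltW b0).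
  rewrite !mem_set//; last first.
    exact: decision_region_comb (ltW pp) (ltW qp) pq1 Dv Dw.
  have zE : Num.sqrt z *: (p *: v + q *: w) =
      t *: (Num.sqrt x *: v) + (1 - t) *: (Num.sqrt y *: w).
    rewrite scalerDr !scalerA; congr (_ *: _ + _ *: _);
      by rewrite /p /q; field; rewrite gt_eqF ?S0.
  rewrite /noise_density zE.
  apply: (wgm_lt_scale t01 (m0 _ x0) (m0 _ y0) (m0 _ z0)) => //.
  exact: (log_concave_on_wgm hp1_lc).
have := prekopa_leindler t01 pp qp k0 (mF x) (mF y) (mF z)
  (F0 x) (F0 y) (F0 z) FK.
(* As [m gamma] is sqrt gamma ^ n, the two factors are n-th powers, of sqrt z / (sqrt x ^ t sqrt y ^
   (1 - t)) and of its inverse. *)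
rewrite (_ : k * _ = 1)//.
have -> : p / t = Num.sqrt x / Num.sqrt z.
  by rewrite /p; field; rewrite !gt_eqF ?S0.
have -> : q / (1 - t) = Num.sqrt y / Num.sqrt z.
  by rewrite /q; field; rewrite !gt_eqF ?S0.
have powX (a r : R) : 0 < a -> (a ^+ n) `^ r = (a `^ r) ^+ n.
  by move=> a0; rewrite -!powR_mulrn ?powR_ge0 ?(ltW a0)// powRAC.
rewrite /k !mE// !powX ?S0// !powR_div ?S0//.
have E : Num.sqrt z `^ t * Num.sqrt z `^ (1 - t) = Num.sqrt z.
  by rewrite -powRD ?subrKC ?powRr1 ?sqrtr_ge0// gt_eqF ?S0// implybT.
rewrite mulrACA -invfM E -!exprMn -exprVn -!exprMn.
rewrite (_ : _ * _ = 1) ?expr1n//.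
by field; rewrite !gt_eqF ?powR_gt0 ?S0.
Qed.
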